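(* Assume that $\zeta_{n,1}\ge1$ a.s. for all $n\ge0$, that all $\zeta_{n,j}$ have a common distribution $G$ (the same for all $n$), and that $q=\mathbb{P}(\zeta_{1,1}>1)>0$. Assume also that the distribution $F$ of the increments of the branching random walk has a heavy right tail, i.e. $\int_{-\infty}^\infty e^{\lambda t}F(dt)=\infty$ for all $\lambda>0$. Then, for any $c\in\mathbb{R}$, $$R^{\widehat c}\equiv\sup_{n}R_n^{\widehat c}=\infty\quad\text{a.s.},$$ where $R_n^{\widehat c}=\max_{\pi:|\pi|\le n}(S(\pi)-c|\pi|)$.
   Context: Branching process: $Z_0=1$, $Z_{n+1}=\sum_{j=1}^{Z_n}\zeta_{n,j}$ for $n\ge 0$, where the non-negative integer-valued variables $\zeta_{n,j}$ are i.i.d. over $j$ for each $n$, and the sequences for different $n\ge 0$ are mutually independent. Its genealogical tree has $Z_n$ vertices in generation $n$, numbered $1,\dots,Z_n$, vertex $j$ of generation $n$ having $\zeta_{n,j}$ children in generation $n+1$. Branching random walk: $\{\xi,\xi_{i,k}\}_{i,k\ge0}$ are i.i.d. with distribution function $F$, $\mathbb{E}\xi=0$, and the family $\{\xi_{i,k}\}$ is independent of $\{\zeta_{n,j}\}$; the edge ending at vertex $i$ of generation $k$ carries the increment $\xi_{i,k}$. For a finite path $\pi$ in the tree starting from the root, $|\pi|$ is its number of edges and $S(\pi)$ is the sum of the increments along its edges ($S(\emptyset)=0$ for the empty path). *)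

(* Defs.v *)
From HB Require Import structures.
From mathcomp Require Import all_boot all_order all_algebra finmap.
From mathcomp Require Import all_classical all_reals all_analysis.

Set Implicit Arguments.
Unset Strict Implicit.
Unset Printing Implicit Defensive.

Import Order.TTheory GRing.Theory Num.Theory.
Import numFieldNormedType.Exports.
Local Open Scope classical_set_scope.
Local Open Scope ring_scope.

Section independence.
Context {d : measure_display} {T : measurableType d} {R : realType}.
Variable P : probability T R.

Definition independent_systems (I : choiceType) (D : set I)
    (G : I -> set (set T)) : Prop :=
  forall (J : {fset I}) (A : I -> set T),
    [set` J] `<=` D -> (forall i, i \in J -> G i (A i)) ->
    P (\bigcap_(i in [set` J]) A i) = (\prod_(i <- J) P (A i))%E.

Definition sigma_generated {d' : measure_display} {U : measurableType d'}
    (I : Type) (D : set I) (X : I -> T -> U) : set (set T) :=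
  <<s \bigcup_(i in D) preimage_set_system setT (X i) measurable >>.

Definition independent_rvs {d' : measure_display} {U : measurableType d'}
    (I : choiceType) (D : set I) (X : I -> T -> U) : Prop :=
  independent_systems D (fun i => preimage_set_system setT (X i) measurable).

Definition independent2 (G H : set (set T)) : Prop :=
  forall A B, G A -> H B -> P (A `&` B) = (P A * P B)%E.

Definition has_law {d' : measure_display} {U : measurableType d'}
    (X : {RV P >-> U}) (mu : probability U R) : Prop :=
  forall A, measurable A -> distribution P X A = mu A.

End independence.

Definition heavy_right_tail (R : realType)
    (F : probability (measurableTypeR R) R) : Prop :=
  forall lambda : R, 0 < lambda ->
    (\int[F]_t (expR (lambda * t))%:E = +oo)%E.

(* Below, z n j is the number of children of vertex j (numbered from 1) of
   generation n, in one realisation of the tree. *)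
Section genealogical_tree.
Variable z : nat -> nat -> nat.

Fixpoint gen_size (n : nat) : nat :=
  (if n is m.+1 then \sum_(1 <= j < (gen_size m).+1) z m j else 1)%N.

(* The vertices of generation n.+1 are numbered in the order of their parents:
   the children of vertex j come just after those of vertices 1, ..., j - 1. *)
Definition children (n j : nat) : seq nat :=
  iota (\sum_(1 <= l < j) z n l)%N.+1 (z n j).

(* A path of m edges from the root is the list [:: v_1; ...; v_m] of its
   vertices in generations 1, ..., m; the root is vertex 1 of generation 0. *)
Fixpoint root_paths (m : nat) : seq (seq nat) :=
  if m is k.+1 then
    [seq rcons p v | p <- root_paths k, v <- children k (last 1%N p)]
  else [:: [::]].

Definition root_paths_le (n : nat) : seq (seq nat) :=
  flatten [seq root_paths m | m <- iota 0 n.+1].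

(* The endpoints of the paths of length n are the vertices 1, ..., Z_n. *)
Lemma last_root_paths (n : nat) :
  [seq last 1%N p | p <- root_paths n] = iota 1 (gen_size n).
Proof.
elim: n => [//|n IHn] /=.
rewrite map_flatten -map_comp.
have -> : [seq (map (last 1%N) \o
      (fun p => [seq rcons p v | v <- children n (last 1%N p)])) p
      | p <- root_paths n] = [seq children n j | j <- iota 1 (gen_size n)].
  rewrite -IHn -map_comp; apply: eq_map => p /=.
  by rewrite -map_comp -[RHS]map_id; apply: eq_map => v /=; rewrite last_rcons.
elim: (gen_size n) => [|k IHk]; first by rewrite big_nil.
rewrite -[in LHS](addn1 k) iotaD map_cat flatten_cat IHk /= cats0 add1n.
by rewrite [in RHS]big_nat_recr //= iotaD add1n.
Qed.

End genealogical_tree.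

Section branching_walk.
Variable R : realType.

(* x i k is the increment on the edge ending at vertex i of generation k. *)
Definition path_sum (x : nat -> nat -> R) (p : seq nat) : R :=
  \sum_(k < size p) x (nth 0%N p k) k.+1.

(* The default value 0 of the maximum is the value at the empty path, which
   belongs to root_paths_le z n for every n. *)
Definition path_max (z : nat -> nat -> nat) (x : nat -> nat -> R) (c : R)
    (n : nat) : R :=
  \big[Num.max/0]_(p <- root_paths_le z n) (path_sum x p - c * (size p)%:R).

End branching_walk.

(* Main.v *)
Require Import Defs.
From mathcomp Require Import all_boot all_order all_algebra finmap.
From mathcomp Require Import all_classical all_reals all_analysis.
From mathcomp Require Import measurable_realfun lra ring.
Import Order.TTheory GRing.Theory Num.Theory.
Import numFieldNormedType.Exports.
Local Open Scope classical_set_scope.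
Local Open Scope ring_scope.
Set Implicit Arguments.
Unset Strict Implicit.
Unset Printing Implicit Defensive.

(** The tree grows exponentially fast, while the heavy right tail makes some
    increments exceed a large multiple of their generation, and such an increment
    is unlikely to be cancelled by the earlier part of its path.

    Growth. Given [Z_n = k], the inequality between harmonic and arithmetic means
    bounds [1 / Z_(n+1)] by [1 / k] times the average of the inverse offspring
    numbers, which are independent of [Z_n] and have a mean [r < 1]. So the mean
    of [1 / Z_n] is at most [r ^ n] ([expect_inv_gen_size]), and for some [b > 1]
    the probability that [Z_n < delta * b ^ n] for some [n] is at most
    proportional to [delta] ([slow_growth_prob]).

    Big steps. Let the tree be deterministic and let [p_n = P (xi > K n)]. The
    probability that no edge of generations [N], ..., [M] has an increment larger
    than [K] times its generation is at most [exp (- sum_n Z_n p_n)]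
    ([no_big_step_le]). The sum of the [b ^ n p_n] diverges, because otherwise
    [exp (lambda xi)] would have a finite mean for [lambda = ln b / K]
    ([heavy_right_tail_series]). Select a big step of the largest generation,
    say [n]. This selection depends only on the increments of generations at
    least [n], hence it is independent of the increments on the way to this edge,
    whose negative parts have a total mean less than [n m], where [m] is the mean
    of the negative part of [xi]. By Markov's inequality they reach [K n / 2]
    with probability at most [2 m / K] ([low_paths_big_step]). Otherwise the path
    has a sum of at least [K n / 2], and a value of at least [n] if
    [K / 2 >= 1 + c].

    The tree up to generation [M] takes countably many values and is independent
    of the increments, so that these bounds can be integrated over the tree
    ([measure_discrete_conditioning]). As [K] is arbitrarily large and [delta]
    arbitrarily small, the values of the paths are bounded by a given [B] with
    probability 0 ([low_paths_negligible]). *)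

(** * Countably valued variables and conditioning *)

(** Measurability of a countably valued function for the discrete
    sigma-algebra, stated through its fibers so that it makes sense for every
    [countType], such as lists of paths. *)
Definition discrete_measurable (d : measure_display) (T : measurableType d)
    (C : countType) (X : T -> C) : Prop :=
  forall c, measurable (X @^-1` [set c]).

Lemma discrete_cst (d : measure_display) (T : measurableType d)
  (C : countType) (c : C) : discrete_measurable (fun _ : T => c).
Proof.
move=> c'; have [<-|cc'] := pselect (c = c').
  by rewrite (_ : _ @^-1` _ = setT)//; apply/seteqP; split.
by rewrite (_ : _ @^-1` _ = set0)//; apply/seteqP; split.
Qed.

(** A discrete variable [Y c] whose choice depends on the value [c] of another
    one; only the attained values of [X] matter, because the numbers of children
    are known to be measurable only for vertices numbered from 1. *)
Lemma discrete_bind (d : measure_display) (T : measurableType d)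
  (C D : countType) (X : T -> C) (Y : C -> T -> D) :
  discrete_measurable X -> (forall w, discrete_measurable (Y (X w))) ->
  discrete_measurable (fun w => Y (X w) w).
Proof.
move=> mX mY y.
rewrite (_ : _ @^-1` _ = \bigcup_c (X @^-1` [set c] `&` Y c @^-1` [set y])).
  apply: countable_bigcupT_measurable; first exact: countableP.
  move=> c; have [[w <-]|nc] := pselect (exists w, X w = c).
    by apply: measurableI; [exact: mX|exact: mY].
  rewrite (_ : X @^-1` [set c] = set0) ?set0I//.
  by apply/seteqP; split=> // w Xw; apply: nc; exists w.
by apply/seteqP; split=> w /=; [exists (X w)|case=> c _ [/= ->]].
Qed.

Lemma discrete_comp (d : measure_display) (T : measurableType d)
  (C D : countType) (X : T -> C) (f : C -> D) :
  discrete_measurable X -> discrete_measurable (fun w => f (X w)).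
Proof.
move=> mX; apply: (discrete_bind (Y := fun c _ => f c)) => // w.
exact: discrete_cst.
Qed.

Lemma discrete_comp2 (d : measure_display) (T : measurableType d)
  (C D E : countType) (X : T -> C) (Y : T -> D) (f : C -> D -> E) :
  discrete_measurable X -> discrete_measurable Y ->
  discrete_measurable (fun w => f (X w) (Y w)).
Proof.
move=> mX mY; apply: (discrete_bind (Y := fun c w => f c (Y w))) => // w.
exact: discrete_comp.
Qed.

Lemma discrete_sum (d : measure_display) (T : measurableType d)
  (Z : nat -> T -> nat) (k : nat) :
  (forall j, (1 <= j)%N -> discrete_measurable (Z j)) ->
  discrete_measurable (fun w => (\sum_(1 <= j < k) Z j w)%N).
Proof.
move=> mZ; elim: k => [|[|k] IH].
- by under eq_fun do rewrite big_geq//; exact: discrete_cst.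
- by under eq_fun do rewrite big_geq//; exact: discrete_cst.
- under eq_fun do rewrite big_nat_recr//=.
  by apply: discrete_comp2 => //; exact: mZ.
Qed.

Lemma discrete_gen_size (d : measure_display) (T : measurableType d)
  (Z : nat -> nat -> T -> nat) (n : nat) :
  (forall m j, (m < n)%N -> (1 <= j)%N -> discrete_measurable (Z m j)) ->
  discrete_measurable (fun w => gen_size (fun m j => Z m j w) n).
Proof.
elim: n => [|n IH] mZ; first exact: discrete_cst.
apply: (discrete_bind
  (Y := fun k w => (\sum_(1 <= j < k.+1) Z n j w)%N)) => [|w].
  by apply: IH => m j mn; apply: mZ; exact: ltnW.
by apply: discrete_sum => j; exact: mZ.
Qed.

Lemma last_root_paths_gt0 (z : nat -> nat -> nat) (n : nat) (p : seq nat) :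
  p \in root_paths z n -> (1 <= last 1%N p)%N.
Proof.
move=> /(map_f (last 1%N)); rewrite last_root_paths mem_iota.
by case/andP.
Qed.

Lemma discrete_root_paths (d : measure_display) (T : measurableType d)
  (Z : nat -> nat -> T -> nat) (n : nat) :
  (forall m j, (1 <= j)%N -> discrete_measurable (Z m j)) ->
  discrete_measurable (fun w => root_paths (fun m j => Z m j w) n).
Proof.
move=> mZ; elim: n => [|n IH]; first exact: discrete_cst.
apply: (discrete_bind (Y := fun l w => [seq rcons p v | p <- l,
  v <- children (fun m j => Z m j w) n (last 1%N p)])) => // w0.
have : forall p, p \in root_paths (fun m j => Z m j w0) n ->
    (1 <= last 1%N p)%N by move=> p; exact: last_root_paths_gt0.
rewrite -/(root_paths _ n).
elim: (root_paths (fun m j => Z m j w0) n) => [|p l IHl] lgt0 /=.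
  exact: discrete_cst.
apply: (discrete_comp2 cat); last first.
  by apply: IHl => q ql; apply: lgt0; rewrite inE ql orbT.
apply: (discrete_comp (map (rcons p))).
apply: (discrete_comp2 (fun a b => iota a.+1 b)).
  by apply: discrete_sum => j; exact: mZ.
by apply: mZ; apply: lgt0; rewrite mem_head.
Qed.

Lemma discrete_root_paths_le (d : measure_display) (T : measurableType d)
  (Z : nat -> nat -> T -> nat) (n : nat) :
  (forall m j, (1 <= j)%N -> discrete_measurable (Z m j)) ->
  discrete_measurable (fun w => root_paths_le (fun m j => Z m j w) n).
Proof.
move=> mZ; rewrite /root_paths_le.
elim: (iota 0 n.+1) => [|m s IH] /=; first exact: discrete_cst.
by apply: (discrete_comp2 cat) => //; exact: discrete_root_paths.
Qed.

(** Conditioning on a countably valued variable [X] that is independent of the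
    events [E c]: if [P (E c) <= eta] whenever [c] belongs to [A], then the event
    that [X] is in [A] and that [E X] occurs has probability at most [eta]. *)
Lemma measure_discrete_conditioning (d : measure_display)
  (T : measurableType d) (R : realType) (P : probability T R)
  (GE GX : set (set T)) (C : countType) (X : T -> C) (E : C -> set T)
  (A : set C) (eta : R) :
  independent2 P GE GX ->
  GE `<=` measurable -> GX `<=` measurable ->
  (forall c, GX (X @^-1` [set c])) -> (forall c, GE (E c)) ->
  (forall c, A c -> (P (E c) <= eta%:E)%E) -> 0 <= eta ->
  measurable [set w | A (X w) /\ E (X w) w] /\
  (P [set w | A (X w) /\ E (X w) w] <= eta%:E)%E.
Proof.
move=> ind GEm GXm GX_X GE_E PE eta0.
pose F n := [set w | choice.pickle (X w) = n /\ A (X w) /\ E (X w) w].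
pose H n := [set w | choice.pickle (X w) = n].
have HF n : [/\ measurable (F n), measurable (H n) &
    (P (F n) <= eta%:E * P (H n))%E].
  have [[c cn]|nc] := pselect (exists c : C, choice.pickle c = n); last first.
    rewrite (_ : F n = set0); last first.
      by apply/seteqP; split=> // w [Xn _]; apply: nc; exists (X w).
    rewrite (_ : H n = set0) ?measure0 ?mule0; first by split.
    by apply/seteqP; split=> // w Xn; apply: nc; exists (X w).
  have HE : H n = X @^-1` [set c].
    apply/seteqP; split=> w /=; rewrite /H/= -cn; last by move=> ->.
    exact: pcan_inj choice.pickleK _ _.
  have mH : measurable (H n) by rewrite HE; apply: GXm; exact: GX_X.
  have [Ac|nA] := pselect (A c); last first.
    rewrite (_ : F n = set0); first by rewrite measure0 mule_ge0.
    apply/seteqP; split=> // w [Xn [+ _]].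
    by have : H n w by []; rewrite HE /= => ->.
  have FE : F n = E c `&` X @^-1` [set c].
    apply/seteqP; split=> w /=.
      move=> [Xn [AX EX]]; have : H n w by [].
      by rewrite HE /= => Xc; rewrite -Xc.
    by case=> Ew Xc; rewrite /F /= Xc.
  split=> //; first by rewrite FE; apply: measurableI; [exact: GEm|exact: GXm].
  rewrite FE ind// HE; apply: lee_wpmul2r => //; exact: PE.
have -> : [set w | A (X w) /\ E (X w) w] = \bigcup_n F n.
  by apply/seteqP; split=> w /=; [exists (choice.pickle (X w))|case=> n _ []].
have mF n : measurable (F n) by have [] := HF n.
have mH n : measurable (H n) by have [] := HF n.
split; first exact: bigcupT_measurable.
apply: (@le_trans _ _ (\sum_(0 <= n <oo) P (F n))%E).
  by apply: measure_sigma_subadditive => //; exact: bigcupT_measurable.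
apply: (@le_trans _ _ (\sum_(0 <= n <oo) (eta%:E * P (H n)))%E).
  by apply: lee_nneseries => [n _ _|n _]; [exact: measure_ge0|have [] := HF n].
rewrite nneseriesZl//.
rewrite -[leRHS]mule1; apply: lee_wpmul2l => //.
have tH : trivIset setT H.
  apply/trivIsetP => i j _ _ ij; apply/seteqP; split=> // w [].
  by rewrite /H /= => Hi Hj; rewrite -Hi -Hj eqxx in ij.
rewrite -measure_semi_bigcup//; last exact: bigcupT_measurable.
by apply: probability_le1; exact: bigcupT_measurable.
Qed.

(** * Integrals, independence and means *)

Lemma measurable_discrete (d : measure_display) (T : measurableType d)
  (C : countType) (X : T -> C) (A : set C) :
  discrete_measurable X -> measurable (X @^-1` A).
Proof.
move=> mX; rewrite (_ : _ @^-1` _ =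
    \bigcup_c (X @^-1` [set c] `&` [set w | A c])); last first.
  apply/seteqP; split=> w /=; first by move=> AX; exists (X w).
  by case=> c _ [/= ->].
apply: countable_bigcupT_measurable; first exact: countableP.
move=> c; have [Ac|nAc] := pselect (A c).
  by rewrite (_ : [set w | _] = setT) ?setIT//; apply/seteqP; split.
by rewrite (_ : [set w | _] = set0) ?setI0//; apply/seteqP; split.
Qed.

Lemma discrete_measurable_fun (d : measure_display) (T : measurableType d)
  (C : countType) (X : T -> C) (d' : measure_display) (U : measurableType d')
  (f : C -> U) :
  discrete_measurable X -> measurable_fun setT (fun w => f (X w)).
Proof.
by move=> mX _ B mB; rewrite setTI; exact: (measurable_discrete (f @^-1` B) mX).
Qed.

(** If the event [D] is independent of [X], then restricting an integral of a
    function of [X] to [D] multiplies it by [P D]. *)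
Lemma integral_indep (d d' : measure_display) (T : measurableType d)
  (U : measurableType d') (R : realType) (P : probability T R)
  (X : {RV P >-> U}) (mu : probability U R) (D : set T) (f : U -> \bar R) :
  measurable D ->
  (forall B, measurable B -> P (D `&` X @^-1` B) = (P D * mu B)%E) ->
  measurable_fun [set: U] f -> (forall u, 0 <= f u)%E ->
  (\int[P]_(w in D) f (X w) = P D * \int[mu]_u f u)%E.
Proof.
move=> mD indep mf f0.
have mfX : measurable_fun [set: T] (fun w => f (X w)).
  by apply: measurableT_comp => //; exact: measurable_funPT.
transitivity (\int[mrestr P mD]_(w in D) f (X w))%E.
  apply: eq_measure_integral => A mA AD; rewrite -[RHS]/(P (A `&` D)).
  by congr (P _); apply/esym/setIidPl.
transitivity (\int[mrestr P mD]_w f (X w))%E.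
  rewrite (@ge0_negligible_integral _ _ _ (mrestr P mD) setT (~` D))//.
  - by rewrite setTD setCK.
  - exact: measurableC.
  - by rewrite -[LHS]/(P (~` D `&` D)) setICl measure0.
rewrite -(@ge0_integral_pushforward _ _ _ _ _ X _ (mrestr P mD) setT f)//.
pose pD : {nonneg R} := NngNum (fine_ge0 (measure_ge0 P D)).
have pDE : ((pD%:num)%:E = P D)%E by rewrite /= fineK// fin_num_measure.
transitivity (\int[mscale pD mu]_u f u)%E.
  apply: eq_measure_integral => A mA _.
  rewrite -[LHS]/(P (X @^-1` A `&` D)) setIC indep//.
  by rewrite -[RHS]/((pD%:num)%:E * mu A)%E pDE.
by rewrite ge0_integral_mscale// pDE.
Qed.

(** Markov's inequality on an event [D]. *)
Lemma markov_on (d : measure_display) (T : measurableType d)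
  (R : realType) (P : probability T R) (D : set T) (g : T -> R) (a : R) :
  measurable D -> measurable_fun [set: T] g -> (forall w, 0 <= g w) -> 0 < a ->
  (P (D `&` [set w | (a <= g w)%R]) <= a^-1%:E * \int[P]_(w in D) (g w)%:E)%E.
Proof.
move=> mD mg g0 a0.
have mg' : measurable_fun D (EFin \o g).
  by apply/measurable_EFinP; exact: measurable_funTS.
have := @le_integral_abse _ _ _ P D mD (EFin \o g) a mg' a0.
rewrite (_ : D `&` _ = D `&` [set w | a <= g w]); last first.
  by apply/seteqP; split=> w /= [Dw]; rewrite ger0_norm// lee_fin.
rewrite (_ : (\int[P]_(x in D) _)%E = (\int[P]_(w in D) (g w)%:E)%E); last first.
  by apply: eq_integral => w _ /=; rewrite ger0_norm.
move=> /(lee_wpmul2l (x := a^-1%:E)); rewrite lee_fin invr_ge0 (ltW a0).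
by move=> /(_ isT); rewrite muleA -EFinM mulVf ?gt_eqF// mul1e.
Qed.

(** The inequality between the harmonic and arithmetic means. *)
Lemma am_hm (R : realType) (k : nat) (a : nat -> R) :
  (0 < k)%N -> (forall j, 0 < a j) ->
  (\sum_(1 <= j < k.+1) a j)^-1 <=
  k%:R ^- 2 * \sum_(1 <= j < k.+1) (a j)^-1.
Proof.
move=> k0 a0; set A := \sum_(1 <= j < k.+1) a j.
have kR : 0 < k%:R :> R by rewrite ltr0n.
have A0 : 0 < A.
  rewrite /A big_nat_recl//; apply: ltr_wpDr => //.
  by apply: sumr_ge0 => j _; exact: ltW.
(* the convex function x^-1 lies above its tangent at the mean A / k *)
have tangent j : 2 * k%:R / A - a j * (k%:R / A) ^+ 2 <= (a j)^-1.
  rewrite -subr_ge0 (_ : _ - _ = (1 - a j * (k%:R / A)) ^+ 2 / a j).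
    by rewrite divr_ge0 ?sqr_ge0 ?ltW.
  by field; rewrite !gt_eqF.
have : \sum_(1 <= j < k.+1) (2 * k%:R / A - a j * (k%:R / A) ^+ 2) <=
    \sum_(1 <= j < k.+1) (a j)^-1 by apply: ler_sum.
rewrite sumrB -!mulr_suml -/A sumr_const_nat subn1 /= => H.
rewrite mulrC ler_pdivlMr ?exprn_gt0//; apply: le_trans H.
rewrite le_eqVlt; apply/orP; left; apply/eqP.
by rewrite -mulr_natr; field; rewrite gt_eqF.
Qed.

(** * Growth of the tree *)

Lemma bigcap_fsetU1 (T : Type) (I : choiceType) (n : I) (J : {fset I})
  (A A' : I -> set T) (C : set T) :
  n \notin J -> A' n = C -> (forall i, i \in J -> A' i = A i) ->
  \bigcap_(i in [set` (n |` J)%fset]) A' i =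
  C `&` \bigcap_(i in [set` J]) A i.
Proof.
move=> nJ An AJ; apply/seteqP; split=> w /=.
  move=> H; split; first by rewrite -An; apply: H; rewrite /= fset1U1.
  by move=> i iJ; rewrite -AJ//; apply: H; rewrite /= fset1Ur.
move=> [Cw H] i /=; rewrite in_fset1U => /predU1P[->|iJ]; first by rewrite An.
by rewrite AJ//; exact: H.
Qed.

Lemma bigcap_fset1 (T : Type) (I : choiceType) (n : I) (A : I -> set T) :
  \bigcap_(i in [set` [fset n]%fset]) A i = A n.
Proof.
apply/seteqP; split=> [w H|w Bw i /=]; last by rewrite inE => /eqP ->.
by apply: (H n); rewrite /= inE.
Qed.

(** The size of generation [n] is independent of any finite number of events
    about the offspring numbers of generations from [n] on. *)
Lemma gen_size_indep (d : measure_display) (T : measurableType d)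
  (R : realType) (P : probability T R) (Gs : nat -> set (set T))
  (Z : nat -> nat -> T -> nat) :
  independent_systems P [set: nat] Gs ->
  (forall n, Gs n `<=` measurable) ->
  (forall n j, (1 <= j)%N -> discrete_measurable (Z n j)) ->
  (forall n k k', Gs n [set w | (\sum_(1 <= j < k.+1) Z n j w)%N = k']) ->
  forall n k (J : {fset nat}) (A : nat -> set T),
  (forall i, i \in J -> (n <= i)%N /\ Gs i (A i)) ->
  (P ([set w | gen_size (fun m j => Z m j w) n = k] `&`
      \bigcap_(i in [set` J]) A i) =
   P [set w | gen_size (fun m j => Z m j w) n = k] *
   P (\bigcap_(i in [set` J]) A i))%E.
Proof.
move=> ind Gm mZ GZ; pose S n k := [set w | gen_size (fun m j => Z m j w) n = k].
pose C n k k' := [set w | (\sum_(1 <= j < k.+1) Z n j w)%N = k'].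
have mS n k : measurable (S n k).
  by apply: (@discrete_gen_size _ _ Z n _ k) => m j _; exact: mZ.
elim=> [|n IH] k' J A JA.
  have [->|k1] := eqVneq k' 1%N.
    rewrite (_ : [set w | _] = setT); last by apply/seteqP; split.
    by rewrite setTI probability_setT mul1e.
  rewrite (_ : [set w | _] = set0); last first.
    by apply/seteqP; split=> // w /= /eqP; rewrite eq_sym (negbTE k1).
  by rewrite set0I measure0 mul0e.
have mJA : measurable (\bigcap_(i in [set` J]) A i).
  apply: fin_bigcap_measurable => // i iJ.
  by apply: (Gm i); have [] := JA i iJ.
have SE : [set w | gen_size (fun m j => Z m j w) n.+1 = k'] =
    \bigcup_k (S n k `&` C n k k').
  apply/seteqP; split=> w /=; last by case=> k _ [<-].
  by move=> H; exists (gen_size (fun m j => Z m j w) n).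
have nJ : n \notin J by apply/negP => /JA[]; rewrite ltnn.
have ind1 k (B : set T) : Gs n B ->
    P (S n k `&` (B `&` \bigcap_(i in [set` J]) A i)) =
    (P (S n k) * P B * P (\bigcap_(i in [set` J]) A i))%E.
  move=> GB; pose A' i := if i == n then B else A i.
  have A'n : A' n = B by rewrite /A' eqxx.
  have A'J i : i \in J -> A' i = A i.
    by rewrite /A'; case: eqP => // ->; rewrite (negbTE nJ).
  have GA' i : i \in (n |` J)%fset -> (n <= i)%N /\ Gs i (A' i).
    rewrite in_fset1U => /predU1P[->|iJ]; first by rewrite A'n.
    by rewrite A'J//; have [/ltnW] := JA i iJ.
  rewrite -(bigcap_fsetU1 nJ A'n A'J) IH// -muleA; congr (_ * _)%E.
  rewrite ind//; last by move=> i /GA'[].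
  rewrite big_fsetU1//= A'n; congr (_ * _)%E.
  rewrite ind//; last by move=> i /JA[].
  by apply: eq_big_seq => i iJ; rewrite A'J.
have ind2 k (B : set T) : Gs n B -> P (S n k `&` B) = (P (S n k) * P B)%E.
  move=> GB; have := IH k [fset n]%fset (fun=> B).
  by rewrite bigcap_fset1; apply=> i; rewrite inE => /eqP ->.
have tS (B : nat -> set T) : trivIset setT (fun k => S n k `&` B k).
  apply/trivIsetP => i j _ _ ij; apply/seteqP; split=> // w [[Hi _] [Hj _]].
  by rewrite -Hi -Hj eqxx in ij.
have mSC k : measurable (S n k `&` C n k k').
  by apply: measurableI => //; apply: (Gm n); exact: GZ.
rewrite SE setI_bigcupl measure_semi_bigcup; last 3 first.
- by move=> k; apply: measurableI.
- by under eq_fun do rewrite -setIA; exact: tS.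
- by apply: bigcupT_measurable => k; exact: measurableI.
rewrite measure_semi_bigcup//; last exact: bigcupT_measurable.
rewrite -(@fineK _ (P (\bigcap_(i in [set` J]) A i))) ?fin_num_measure//.
rewrite muleC -nneseriesZl//.
apply: eq_eseriesr => k _.
rewrite -setIA; apply: (etrans (ind1 k _ (GZ n k k'))).
rewrite fineK ?fin_num_measure// muleC; congr (_ * _)%E.
exact: (esym (ind2 k _ (GZ n k k'))).
Qed.

Lemma gen_size_gt0 (z : nat -> nat -> nat) (n : nat) :
  (forall m j, (1 <= j)%N -> (0 < z m j)%N) -> (0 < gen_size z n)%N.
Proof.
move=> z0; elim: n => [//|n IH] /=.
by rewrite big_nat_recl// addn_gt0 z0.
Qed.

(** Since [1 / Z_(n+1)] is at most [1 / Z_n] times the average of the inverse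
    offspring numbers of generation [n], the mean of [1 / Z_n] is at most [r ^ n]
    when [r] is the mean of an inverse offspring number. *)
Lemma expect_inv_gen_size (d : measure_display) (T : measurableType d)
  (R : realType) (P : probability T R) (Z : nat -> nat -> T -> nat) (r : R) :
  0 <= r ->
  (forall n j, discrete_measurable (Z n j)) ->
  (forall n j w, (0 < Z n j w)%N) ->
  (forall n k j, (1 <= j)%N ->
    (\int[P]_(w in [set w | gen_size (fun m i => Z m i w) n = k])
       ((Z n j w)%:R^-1)%:E =
     r%:E * P [set w | gen_size (fun m i => Z m i w) n = k])%E) ->
  forall n, (\int[P]_w ((gen_size (fun m i => Z m i w) n)%:R^-1)%:E
    <= (r ^+ n)%:E)%E.
Proof.
move=> r0 mZ Z0 HZ; pose N n w := gen_size (fun m i => Z m i w) n.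
pose S n k := [set w | N n w = k].
have mN n : discrete_measurable (N n).
  by apply: discrete_gen_size => m j _ _; exact: mZ.
have mS n k : measurable (S n k) by exact: mN.
have mg n j : measurable_fun [set: T] (fun w => ((Z n j w)%:R^-1)%:E : \bar R).
  exact: (discrete_measurable_fun (fun k : nat => (k%:R^-1)%:E : \bar R)).
have tS n : trivIset setT (S n).
  apply/trivIsetP => i j _ _ ij; apply/seteqP; split=> // w [Hi Hj].
  by rewrite -Hi -Hj eqxx in ij.
have US n : setT = \bigcup_k S n k.
  by apply/seteqP; split=> // w _; exists (N n w).
have mf n : measurable_fun [set: T] (fun w => ((N n w)%:R^-1)%:E : \bar R).
  exact: (discrete_measurable_fun (fun k : nat => (k%:R^-1)%:E : \bar R)).
have f0 n w : (0 <= ((N n w)%:R^-1)%:E :> \bar R)%E.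
  by rewrite lee_fin invr_ge0.
have split_int n m : (\int[P]_w ((N n w)%:R^-1)%:E =
    \sum_(0 <= k <oo) \int[P]_(w in S m k) ((N n w)%:R^-1)%:E)%E.
  by rewrite (US m) ge0_integral_bigcup// -US.
elim=> [|n IH].
  rewrite expr0 (eq_integral (cst 1%:E)); last by move=> w _; rewrite /= invr1.
  by rewrite integral_cst// mul1e; exact: probability_le1.
rewrite -[X in (X <= _)%E]/(\int[P]_w ((N n.+1 w)%:R^-1)%:E)%E (split_int _ n).
have {}IH : (\int[P]_w ((N n w)%:R^-1)%:E <= (r ^+ n)%:E)%E := IH.
apply: (@le_trans _ _ (\sum_(0 <= k <oo)
    (r%:E * \int[P]_(w in S n k) ((N n w)%:R^-1)%:E))%E); last first.
  rewrite nneseriesZl; last by move=> k _; apply: integral_ge0 => w _; exact: f0.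
  by rewrite -split_int exprS EFinM lee_wpmul2l.
apply: lee_nneseries => [k _ _|k _].
  by apply: integral_ge0 => w _; exact: f0.
have [->|k0] := posnP k.
  rewrite (_ : S n 0%N = set0) ?integral_set0 ?mule0//.
  apply/seteqP; split=> // w Hw; have : (0 < N n w)%N.
    by apply: gen_size_gt0 => m j _; exact: Z0.
  by rewrite Hw.
rewrite [X in (_ <= _ * X)%E](eq_integral (cst (k%:R^-1)%:E)); last first.
  by move=> w; rewrite inE => -[->].
rewrite integral_cst//.
apply: (@le_trans _ _ (\int[P]_(w in S n k)
   ((k%:R ^- 2)%:E * \sum_(1 <= j < k.+1) ((Z n j w)%:R^-1)%:E))%E).
  apply: ge0_le_integral => //.
  - exact: measurable_funTS.
  - apply: measurable_funTS; apply: measurable_funeM.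
    by apply: emeasurable_sum => j; exact: mg.
  - move=> w Sw; rewrite sumEFin -EFinM lee_fin.
    have -> : N n.+1 w = (\sum_(1 <= j < k.+1) Z n j w)%N by rewrite -Sw.
    by rewrite natr_sum; apply: am_hm => // j; rewrite ltr0n.
rewrite ge0_integralZl//; last 2 first.
- apply: measurable_funTS.
  by apply: emeasurable_sum => j; exact: mg.
- by move=> w _; apply: sume_ge0 => j _; rewrite lee_fin invr_ge0.
rewrite ge0_integral_sum//; last by move=> j; apply: measurable_funTS; exact: mg.
rewrite big_nat_cond.
rewrite (eq_bigr (fun=> (r%:E * P (S n k))%E)); last first.
  by move=> j /andP[/andP[j1 _] _]; exact: HZ.
rewrite -big_nat_cond -(@fineK _ (P (S n k))) ?fin_num_measure//.
rewrite -EFinM sumEFin sumr_const_nat subn1 /=.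
set p := fine _; have -> : (r * p *+ k = k%:R ^+ 2 * (r * (k%:R^-1 * p)))%R.
  by rewrite -mulr_natr; field; rewrite pnatr_eq0 -lt0n.
rewrite (EFinM (k%:R ^+ 2)) muleA -(EFinM (k%:R ^- 2)) mulVf.
  by rewrite mul1e !EFinM /p fineK// fin_num_measure.
by rewrite expf_neq0// pnatr_eq0 -lt0n.
Qed.

Lemma sigma_generated_preimage (d : measure_display) (T : measurableType d)
  (d' : measure_display) (U : measurableType d') (I : Type) (D : set I)
  (X : I -> T -> U) (i : I) (B : set U) :
  D i -> measurable B -> sigma_generated D X (X i @^-1` B).
Proof.
move=> Di mB; apply: sub_sigma_algebra; exists i => //.
by exists B => //; rewrite setTI.
Qed.

Lemma sigma_generated_measurable (d : measure_display) (T : measurableType d)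
  (d' : measure_display) (U : measurableType d') (I : Type) (D : set I)
  (X : I -> T -> U) :
  (forall i, measurable_fun [set: T] (X i)) ->
  sigma_generated D X `<=` measurable.
Proof.
move=> mX; apply: smallest_sub; first exact: sigma_algebra_measurable.
by move=> _ [i Di [B mB <-]]; exact: mX.
Qed.

(** The type [T] with the sigma-algebra generated by the [X i], [i] in [D]:
    measurability from this space is membership in [sigma_generated D X]. *)
Definition generated_space (d : measure_display) (T : measurableType d)
    (d' : measure_display) (U : measurableType d') (I : Type) (D : set I)
    (X : I -> T -> U) :=
  g_sigma_algebraType
    (\bigcup_(i in D) preimage_set_system [set: T] (X i) measurable).

Lemma discrete_generated (d : measure_display) (T : measurableType d)
  (I : Type) (D : set I) (X : I -> T -> nat) (i : I) :
  D i -> discrete_measurable (X i : generated_space D X -> nat).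
Proof. by move=> Di c; exact: sigma_generated_preimage. Qed.

Lemma geometric_le (R : realType) (x : R) (n : nat) :
  0 <= x -> x < 1 -> \sum_(k < n) x ^+ k <= (1 - x)^-1.
Proof.
move=> x0 x1; rewrite -div1r ler_pdivlMr ?subr_gt0//.
rewrite mulrC -opprB mulNr -subrX1 opprB.
by rewrite gerBl exprn_ge0.
Qed.

(** Truncation at 1 makes the inverse meaningful; it is almost surely the
    identity for offspring numbers that are at least 1. *)
Lemma mean_inv_offspring (R : realType) (G : probability nat R) :
  (0 < G [set k | (1 < k)%N])%E ->
  exists2 r : R, 0 <= r < 1 &
    (\int[G]_k (((maxn 1 k)%:R : R)^-1)%:E = r%:E)%E.
Proof.
move=> q0; pose h (k : nat) : R := (maxn 1 k)%:R^-1.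
have h0 k : 0 <= h k by rewrite invr_ge0.
have h1 k : (0 <= (h k)%:E :> \bar R)%E by rewrite lee_fin.
pose A := [set k : nat | (1 < k)%N].
have mA : measurable A by [].
have mh : measurable_fun [set: nat] (fun k => (h k)%:E : \bar R) by [].
have : (\int[G]_k ((h k)%:E + (2^-1 * \1_A k)%:E) <= \int[G]_k cst 1%:E k)%E.
  apply: ge0_le_integral => //.
  - by move=> k _; rewrite adde_ge0// lee_fin mulr_ge0.
  - move=> k _; rewrite -EFinD lee_fin indicE /h.
    case: (ltnP 1 k) => k1.
      rewrite mem_set// mulr1.
      suff H : k%:R^-1 <= 2^-1 :> R by lra.
      by rewrite lef_pV2 ?posrE ?ltr0n ?(ltn_trans _ k1)// ler_nat.
    rewrite memNset; last by rewrite /A /= ltnNge k1.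
    by rewrite mulr0 addr0 invr1.
rewrite ge0_integralD//.
rewrite [X in (_ + X)%E](eq_integral (fun k => (2^-1)%:E * (\1_A k)%:E)%E)//.
rewrite ge0_integralZl//.
rewrite integral_indic// setIT integral_cst// mul1e.
move=> /le_trans /(_ (probability_le1 G measurableT)).
rewrite -[X in (_ + _ * X)%E]/(G A) -[X in (X + _)%E]/(\int[G]_k (h k)%:E)%E.
have : (0 <= \int[G]_k (h k)%:E)%E by exact: integral_ge0.
have /fineK <- : G A \is a fin_num by rewrite fin_num_measure.
case: (\int[G]_k (h k)%:E)%E => [r| |]//.
rewrite lee_fin => r0.
rewrite -EFinM -EFinD lee_fin => H.
have : 0 < fine (G A) by rewrite fine_gt0// q0 ltey_eq fin_num_measure.
by exists r => //; apply/andP; split=> //; lra.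
Qed.

(** The event that some generation up to [M] has size below [delta * b ^ n]. *)
Definition slow_growth (T : Type) (R : realType) (Z : nat -> nat -> T -> nat)
    (b delta : R) (M : nat) : set T :=
  [set w | exists2 n, (n <= M)%N &
    (gen_size (fun m j => Z m j w) n)%:R < delta * b ^+ n].

Lemma slow_growth_bigcup (T : Type) (R : realType) (Z : nat -> nat -> T -> nat)
  (b delta : R) (M : nat) :
  slow_growth Z b delta M = \big[setU/set0]_(n < M.+1)
    [set w | (gen_size (fun m j => Z m j w) n)%:R < delta * b ^+ n].
Proof.
rewrite -(bigcup_mkord _ (fun n =>
  [set w | (gen_size (fun m j => Z m j w) n)%:R < delta * b ^+ n])).
by apply/seteqP; split=> w /= [n nM H]; exists n.
Qed.

Lemma measurable_gen_size_lt (d : measure_display) (T : measurableType d)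
  (R : realType) (Z : nat -> nat -> T -> nat) (n : nat) (x : R) :
  (forall n j, discrete_measurable (Z n j)) ->
  measurable [set w | (gen_size (fun m j => Z m j w) n)%:R < x].
Proof.
move=> mZ; apply: (measurable_discrete [set k : nat | k%:R < x]).
by apply: discrete_gen_size => m j _ _; exact: mZ.
Qed.

Lemma measurable_slow_growth (d : measure_display) (T : measurableType d)
  (R : realType) (Z : nat -> nat -> T -> nat) (b delta : R) (M : nat) :
  (forall n j, discrete_measurable (Z n j)) ->
  measurable (slow_growth Z b delta M).
Proof.
move=> mZ; rewrite slow_growth_bigcup; apply: bigsetU_measurable => n _.
exact: measurable_gen_size_lt.
Qed.

Lemma slow_growth_expect_inv (d : measure_display) (T : measurableType d)
  (R : realType) (P : probability T R) (Z : nat -> nat -> T -> nat)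
  (r b delta : R) (M : nat) :
  0 < b -> 0 <= r -> b * r < 1 -> 0 < delta ->
  (forall n j, discrete_measurable (Z n j)) ->
  (forall n j w, (0 < Z n j w)%N) ->
  (forall n, (\int[P]_w ((gen_size (fun m i => Z m i w) n)%:R^-1)%:E
    <= (r ^+ n)%:E)%E) ->
  (P (slow_growth Z b delta M) <= ((1 - b * r)^-1 * delta)%:E)%E.
Proof.
move=> b0 r0 br delta0 mZ Z0 HZ; rewrite slow_growth_bigcup.
pose N n w := gen_size (fun m j => Z m j w) n.
have mN n : discrete_measurable (N n).
  by apply: discrete_gen_size => m j _ _; exact: mZ.
have mS n : measurable [set w | (N n w)%:R < delta * b ^+ n].
  exact: measurable_gen_size_lt.
have mf n : measurable_fun [set: T] (fun w => (N n w)%:R^-1 : R).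
  exact: (discrete_measurable_fun (fun k : nat => k%:R^-1 : R)).
apply: (@le_trans _ _ (\sum_(n < M.+1)
    P [set w | ((N n w)%:R < delta * b ^+ n)%R])%E).
  by apply: (Boole_inequality P (A := fun n =>
    [set w | (N n w)%:R < delta * b ^+ n])) => n _; exact: mS.
apply: (@le_trans _ _ (\sum_(n < M.+1) (delta * (b * r) ^+ n)%:E)%E).
  apply: lee_sum => n _.
  have c0 : 0 < delta * b ^+ n by rewrite mulr_gt0 ?exprn_gt0.
  apply: (@le_trans _ _ (P (setT `&`
      [set w | ((delta * b ^+ n)^-1 <= (N n w)%:R^-1)%R]))).
    apply: le_measure; rewrite ?inE; first exact: mS.
      apply: measurableI => //.
      exact: (measurable_discrete
        [set k : nat | (delta * b ^+ n)^-1 <= k%:R^-1]).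
    move=> w /= H; split=> //; rewrite lef_pV2 ?posrE ?ltW//.
    by rewrite ltr0n; apply: gen_size_gt0 => m j _; exact: Z0.
  have v0 : 0 < (delta * b ^+ n)^-1 by rewrite invr_gt0.
  have f0 w : 0 <= (N n w)%:R^-1 :> R by rewrite invr_ge0.
  apply: (le_trans (markov_on P measurableT (mf n) f0 v0)).
  rewrite invrK exprMn mulrA [leRHS]EFinM; apply: lee_wpmul2l; last exact: HZ.
  by rewrite lee_fin ltW.
rewrite sumEFin lee_fin -mulr_sumr [leRHS]mulrC.
apply: ler_wpM2l; first exact: ltW.
by apply: geometric_le => //; rewrite mulr_ge0// ltW.
Qed.

Lemma gen_size_ext (z z' : nat -> nat -> nat) (n : nat) :
  (forall m j, (1 <= j)%N -> z m j = z' m j) -> gen_size z n = gen_size z' n.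
Proof.
move=> zz'; elim: n => [//|n IH] /=; rewrite -IH.
by apply: eq_big_nat => j /andP[j1 _]; exact: zz'.
Qed.

(** Uniformly in [M], the tree grows at least as [delta * b ^ n] up to
    generation [M], outside an event whose probability is at most
    proportional to [delta]. *)
Lemma slow_growth_prob (d : measure_display) (T : measurableType d)
  (R : realType) (P : probability T R)
  (zeta : nat -> nat -> {RV P >-> nat}) (G : probability nat R) :
  independent_systems P [set: nat]
    (fun n => sigma_generated [set j | (1 <= j)%N]
                (fun j => zeta n j : T -> nat)) ->
  (forall n j : nat, (1 <= j)%N -> has_law (zeta n j) G) ->
  G [set 0%N] = 0%E -> (0 < G [set k | (1 < k)%N])%E ->
  exists b C : R, [/\ 1 < b, 0 < C & forall delta M, 0 < delta ->
    measurable (slow_growth (fun m j w => zeta m j w) b delta M) /\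
    (P (slow_growth (fun m j w => zeta m j w) b delta M)
       <= (C * delta)%:E)%E].
Proof.
move=> ind law G0 q0.
have [r /andP[r0 r1] rE] := mean_inv_offspring q0.
pose b := 2 / (1 + r).
have b1 : 1 < b by rewrite /b ltr_pdivlMr; lra.
have br : b * r < 1 by rewrite /b mulrAC ltr_pdivrMr; lra.
exists b, (1 - b * r)^-1; split => //.
  by rewrite invr_gt0 subr_gt0.
move=> delta M delta0.
have mzeta n j : discrete_measurable (zeta n j : T -> nat).
  by move=> c; rewrite -[X in measurable X]setTI; exact: measurable_funPT.
split; first exact: measurable_slow_growth.
(* the offspring numbers are almost surely unchanged by truncation at 1 *)
pose Z n j w := maxn 1 (zeta n j w).
have mZ n j : discrete_measurable (Z n j).
  by apply: discrete_comp; exact: mzeta.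
have Z0 n j w : (0 < Z n j w)%N by rewrite /Z leq_max.
have Pzeta0 n j : (1 <= j)%N -> P.-negligible [set w | zeta n j w = 0%N].
  move=> j1; apply/negligibleP; first exact: mzeta.
  by rewrite -G0 -(law n j j1).
have neg : P.-negligible (\bigcup_n \bigcup_(j in [set j | (1 <= j)%N])
    [set w | zeta n j w = 0%N]).
  apply: negligible_bigcup => n; rewrite bigcup_mkcond.
  apply: negligible_bigcup => j; case: ifPn => [|_]; last exact: negligible_set0.
  by rewrite inE; exact: Pzeta0.
have [N [mN PN sub]] := neg.
pose S := slow_growth Z b delta M.
have mS : measurable S by exact: measurable_slow_growth.
have le1 : (P (slow_growth (fun m j w => zeta m j w) b delta M) <= P (S `|` N))%E.
  apply: le_measure; rewrite ?inE.
  - exact: measurable_slow_growth.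
  - exact: measurableU.
  move=> w [n nM H]; have [Nw|nN] := pselect (N w); [by right|left].
  exists n => //; rewrite (@gen_size_ext _ (fun m j => zeta m j w))// => m j j1.
  apply/maxn_idPr; rewrite lt0n; apply/negP => /eqP z0; apply: nN; apply: sub.
  by exists m => //; exists j.
apply: (le_trans le1); apply: (@le_trans _ _ (P S + P N)%E).
  exact: measureU2.
rewrite PN adde0; apply: (@slow_growth_expect_inv _ _ _ _ _ r) => //.
  by rewrite (lt_trans _ b1).
apply: expect_inv_gen_size => // n k j j1.
pose Gs n := sigma_generated [set j | (1 <= j)%N] (fun j => zeta n j : T -> nat).
have GZ m k1 k2 : Gs m [set w | (\sum_(1 <= j < k1.+1) Z m j w)%N = k2].
  apply: (@discrete_sum _ (generated_space [set j | (1 <= j)%N]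
    (fun j => zeta m j : T -> nat)) (Z m) k1.+1 _ k2) => i i1.
  by apply: discrete_comp; exact: discrete_generated.
have mG m : Gs m `<=` measurable.
  by apply: sigma_generated_measurable => i; exact: measurable_funPT.
have indn := gen_size_indep ind mG (fun n j _ => mZ n j) GZ.
rewrite (@integral_indep _ _ _ _ _ _ (zeta n j) G _
  (fun i => (((maxn 1 i)%:R : R)^-1)%:E))//.
- by rewrite rE muleC.
- by apply: (@discrete_gen_size _ _ Z n _ k) => *; exact: mZ.
- move=> B mB; have := indn n k [fset n]%fset (fun=> zeta n j @^-1` B).
  rewrite bigcap_fset1 => ->; first by rewrite -(law n j j1).
  move=> i; rewrite inE => /eqP ->; split=> //.
  exact: (@sigma_generated_preimage _ _ _ _ _ [set j | (1 <= j)%N]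
    (fun j => zeta n j : T -> nat)).
Qed.

(** * Paths ending with a big step *)

Lemma indep_rvs_seq (d : measure_display) (T : measurableType d)
  (R : realType) (P : probability T R) (d' : measure_display)
  (U : measurableType d') (I : choiceType) (X : I -> {RV P >-> U})
  (F : probability U R) (B : I -> set U) (s : seq I) :
  independent_rvs P [set: I] (fun i => X i : T -> U) ->
  (forall i, has_law (X i) F) -> (forall i, measurable (B i)) -> uniq s ->
  P (\bigcap_(i in [set` s]) X i @^-1` B i) = (\prod_(i <- s) F (B i))%E.
Proof.
move=> ind law mB us; have := ind [fset i in s]%fset (fun i => X i @^-1` B i).
rewrite (_ : [set` [fset i in s]%fset] = [set` s]); last first.
  by apply/seteqP; split=> i /=; rewrite inE.
move=> ->//; last by move=> i _; exists (B i); rewrite ?setTI.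
rewrite (perm_big s) /=; last first.
  by apply: uniq_perm => // i; rewrite inE.
by apply: eq_bigr => i _; rewrite -(law i).
Qed.

(** An event about the variables indexed by [s] is independent of a further
    variable. *)
Lemma indep_rvs_cons (d : measure_display) (T : measurableType d)
  (R : realType) (P : probability T R) (d' : measure_display)
  (U : measurableType d') (I : choiceType) (X : I -> {RV P >-> U})
  (F : probability U R) (B : I -> set U) (s : seq I) (i : I) (A : set U) :
  independent_rvs P [set: I] (fun i => X i : T -> U) ->
  (forall i, has_law (X i) F) -> (forall i, measurable (B i)) -> uniq s ->
  i \notin s -> measurable A ->
  P (\bigcap_(j in [set` s]) X j @^-1` B j `&` X i @^-1` A) =
  (P (\bigcap_(j in [set` s]) X j @^-1` B j) * F A)%E.
Proof.
move=> ind law mB us si mA; pose B' j := if j == i then A else B j.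
have B's j : j \in s -> B' j = B j.
  by rewrite /B'; case: eqP => // ->; rewrite (negbTE si).
rewrite (_ : _ `&` _ = \bigcap_(j in [set` (i :: s)]) X j @^-1` B' j).
  have mB' j : measurable (B' j) by rewrite /B'; case: ifP.
  have uis : uniq (i :: s) by rewrite /= si.
  rewrite (indep_rvs_seq ind law mB' uis) (indep_rvs_seq ind law mB us).
  rewrite big_cons {1}/B' eqxx muleC; congr (_ * _)%E.
  by apply: eq_big_seq => j js; rewrite B's.
apply/seteqP; split=> w /=.
  move=> [H Hi] j /=; rewrite inE => /predU1P[->|js].
    by rewrite /B' eqxx.
  by rewrite B's//; exact: H.
move=> H; split; last first.
  by have := H i; rewrite /= mem_head /B' eqxx; apply.
by move=> j /= js; have := H j; rewrite /= inE js orbT B's//; apply.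
Qed.

(** The edge on which a path ends, as the pair of its end vertex and of the
    generation of that vertex. *)
Definition last_edge (p : seq nat) : nat * nat := (last 1%N p, size p).

(** The event that the paths of [l] all have values [S - c * length] below
    [B]. *)
Definition low_paths (T : Type) (R : realType) (x : nat -> nat -> T -> R)
    (c B : R) (l : seq (seq nat)) : set T :=
  [set w | forall p, p \in l ->
    path_sum (fun i k => x i k w) p - c * (size p)%:R < B].

(** The event that none of the paths in [l] ends with a big step, that is with
    an increment larger than [K] times its length. It is written as an
    intersection over edges, on which independence is known. *)
Definition no_big_step (T : Type) (R : realType) (x : nat -> nat -> T -> R)
    (K : R) (l : seq (seq nat)) : set T :=
  \bigcap_(e in [set` [seq last_edge p | p <- l]])
    x e.1 e.2 @^-1` `]-oo, K * e.2%:R].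

Lemma measurable_low_paths (d : measure_display) (T : measurableType d)
  (R : realType) (x : nat -> nat -> T -> R) (c B : R) (l : seq (seq nat)) :
  (forall i k, measurable_fun [set: T] (x i k)) ->
  measurable (low_paths x c B l).
Proof.
move=> mx.
rewrite (_ : low_paths x c B l = \bigcap_(p in [set` l])
    ((fun w => path_sum (fun i k => x i k w) p - c * (size p)%:R) @^-1`
       `]-oo, B[)); last first.
  by apply/seteqP; split=> w H p /H; rewrite /= in_itv.
apply: fin_bigcap_measurable => // p _; rewrite -[X in measurable X]setTI.
have : measurable_fun [set: T]
    (fun w => path_sum (fun i k => x i k w) p - c * (size p)%:R).
  by apply: measurable_funB => //; apply: measurable_sum => k; exact: mx.
by apply => //; exact: measurable_itv.
Qed.

Lemma path_sum_rcons (R : realType) (x : nat -> nat -> R) (p : seq nat)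
  (v : nat) :
  path_sum x (rcons p v) = path_sum x p + x v (size p).+1.
Proof.
rewrite /path_sum size_rcons big_ord_recr /= nth_rcons ltnn eqxx.
by congr (_ + _); apply: eq_bigr => k _; rewrite nth_rcons ltn_ord.
Qed.

Lemma path_sum_ge (R : realType) (x : nat -> nat -> R) (p : seq nat) :
  - (\sum_(k < size p) Num.max (- x (nth 0%N p k) k.+1) 0) <= path_sum x p.
Proof.
rewrite -sumrN; apply: ler_sum => k _.
by rewrite lerNl le_max lexx.
Qed.

Lemma no_big_step_cons (T : Type) (R : realType) (x : nat -> nat -> T -> R)
  (K : R) (p : seq nat) (l : seq (seq nat)) :
  no_big_step x K (p :: l) = no_big_step x K l `&`
    x (last 1%N p) (size p) @^-1` `]-oo, K * (size p)%:R].
Proof.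
apply/seteqP; split=> w /=.
  move=> H; split; last by apply: (H (last_edge p)); rewrite /= mem_head.
  by move=> e le; apply: H; rewrite /= inE le orbT.
by move=> [H Hp] e /=; rewrite inE => /predU1P[->|le] //; exact: H.
Qed.

Lemma measurable_no_big_step (d : measure_display) (T : measurableType d)
  (R : realType) (x : nat -> nat -> T -> R) (K : R) (l : seq (seq nat)) :
  (forall i k, measurable_fun [set: T] (x i k)) ->
  measurable (no_big_step x K l).
Proof.
move=> mx; apply: fin_bigcap_measurable => // e _.
by rewrite -[X in measurable X]setTI; apply: mx => //; exact: measurable_itv.
Qed.

(** If a path ends with the first big step met when the list is read from its
    end, that is from the largest generations, then its earlier increments are
    still independent of this event, and their negative parts have total mean
    [(n - 1) m], so that they cancel the big step with probability at most
    [2 m / K]. *)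
Lemma low_paths_big_step (d : measure_display) (T : measurableType d)
  (R : realType) (P : probability T R)
  (xi : nat -> nat -> {RV P >-> measurableTypeR R})
  (F : probability (measurableTypeR R) R) (c B K m : R)
  (l : seq (seq nat)) :
  independent_rvs P [set: nat * nat]
     (fun ik => xi ik.1 ik.2 : T -> measurableTypeR R) ->
  (forall i k : nat, has_law (xi i k) F) ->
  (\int[F]_t (Num.max (- t) 0)%:E = m%:E)%E -> 0 < K -> 1 + c <= K / 2 ->
  uniq [seq last_edge p | p <- l] ->
  pairwise (fun p q => size p <= size q)%N l ->
  (forall p, p \in l -> (0 < size p)%N /\ B <= (size p)%:R) ->
  (P (low_paths (fun i k w => xi i k w) c B l `\`
      no_big_step (fun i k w => xi i k w) K l) <=
   (2 * m / K)%:E * (1 - P (no_big_step (fun i k w => xi i k w) K l)))%E.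
Proof.
move=> ind law mE K0 Kc.
pose x i k w := xi i k w : R.
have mx i k : measurable_fun [set: T] (x i k).
  exact: (measurable_funPT (xi i k)).
pose V := low_paths x c B; pose U := no_big_step x K.
have mV q : measurable (V q) by exact: measurable_low_paths.
have mU q : measurable (U q) by exact: measurable_no_big_step.
have m0 : 0 <= m.
  rewrite -lee_fin -mE; apply: integral_ge0 => t _.
  by rewrite lee_fin le_max lexx orbT.
have eps0 : 0 <= 2 * m / K by rewrite divr_ge0 ?mulr_ge0 ?(ltW K0).
rewrite -/x -/(V l) -/(U l).
elim: l => [|p l IH].
  move=> _ _ _; rewrite (_ : _ `\` _ = set0).
    by rewrite measure0 mule_ge0// sube_ge0 ?probability_le1 ?fin_num_measure.
  by rewrite -subset0 => w [_ H]; apply: H => e.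
move=> /= /andP[pl ul] /andP[lep pw] Hl.
have [p0 Bp] : (0 < size p)%N /\ B <= (size p)%:R.
  by apply: Hl; rewrite mem_head.
have {}IH := IH ul pw (fun q ql => Hl q (mem_behead (s := p :: l) ql)).
case/lastP: p => [//|q v] in pl lep p0 Bp Hl *.
pose p := rcons q v; pose N : R := (size p)%:R.
have N0 : 0 < N by rewrite ltr0n.
pose D := U l `\` U (p :: l).
have DE : D = U l `&` x v (size p) @^-1` `]K * N, +oo[.
  rewrite /D /U no_big_step_cons last_rcons -/(U l).
  apply/seteqP; split=> w /= [Uw].
    move=> H; split=> //; rewrite in_itv /= andbT ltNge; apply/negP => H'.
    by apply: H; split=> //; rewrite in_itv.
  by rewrite !in_itv /= andbT => H; split=> // -[_]; rewrite leNgt H.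
have mD : measurable D by exact: measurableD.
have PD : P D = (P (U l) - P (U (p :: l)))%E.
  rewrite /D measureD//; last by rewrite ltey_eq fin_num_measure.
  rewrite setIidr//.
  by rewrite /U no_big_step_cons; exact: subIsetl.
pose g w := \sum_(k < size q) Num.max (- x (nth 0%N q k) k.+1 w) 0.
have mh k : measurable_fun [set: T]
    (fun w => Num.max (- x (nth 0%N q k) k.+1 w) 0).
  by apply: measurable_maxr => //; apply: measurable_funN.
have mg : measurable_fun [set: T] g by exact: measurable_sum.
have sub : V (p :: l) `\` U (p :: l) `<=`
    (V l `\` U l) `|` (D `&` [set w | K / 2 * N <= g w]).
  move=> w [Vw nUw]; have [Uw|nU] := pselect (U l w); [right|left]; last first.
    by split=> // p' p'l; apply: Vw; rewrite inE p'l orbT.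
  split; first by split.
  have : D w by split.
  rewrite DE => -[_]; rewrite /= in_itv /= andbT => big.
  have := Vw _ (mem_head _ _); rewrite path_sum_rcons -/N.
  have := path_sum_ge (fun i k => x i k w) q; rewrite -/(g w).
  rewrite -(size_rcons q v) -/p => ge_q lt_B.
  have : (1 + c) * N <= K / 2 * N by rewrite ler_wpM2r// ltW.
  by rewrite mulrDl; move: Bp; rewrite -/p -/N; lra.
have PDg : (P (D `&` [set w | (K / 2 * N <= g w)%R]) <=
    (2 * m / K)%:E * P D)%E.
  have h0 k w : 0 <= Num.max (- x (nth 0%N q k) k.+1 w) 0.
    by rewrite le_max lexx orbT.
  have a0 : 0 < K / 2 * N by rewrite mulr_gt0 ?divr_gt0.
  have g0 w : 0 <= g w by exact: sumr_ge0.
  apply: (le_trans (markov_on P mD mg g0 a0)).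
  rewrite (eq_integral (fun w => \sum_(k < size q)
    (Num.max (- x (nth 0%N q k) k.+1 w) 0)%:E)%E); last first.
    by move=> w _; rewrite sumEFin.
  rewrite ge0_integral_sum//; last 2 first.
  - by move=> k; apply: measurable_funTS; exact/measurable_EFinP/(mh k).
  - by move=> k w _; rewrite lee_fin.
  rewrite (eq_bigr (fun=> P D * m%:E)%E); last first.
    move=> k _.
    pose h (t : R) : \bar R := (Num.max (- t) 0)%:E.
    pose f := (nth 0%N q k, k.+1).
    apply: (etrans (@integral_indep _ _ _ _ _ _ (xi f.1 f.2) F D h mD _ _ _)).
    - pose s := [seq last_edge p' | p' <- p :: l].
      pose B' e := if e == last_edge p then `]K * e.2%:R, +oo[%classic
                   else `]-oo, (K * e.2%:R)]%classic : set R.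
      have DB : D = \bigcap_(e in [set` s]) xi e.1 e.2 @^-1` B' e.
        have B'l e : e \in [seq last_edge p' | p' <- l] ->
            B' e = `]-oo, (K * e.2%:R)]%classic.
          by rewrite /B'; case: eqP => // ->; rewrite (negbTE pl).
        have B'p : B' (last_edge p) = `]K * N, +oo[%classic.
          by rewrite /B' eqxx.
        rewrite DE; apply/seteqP; split=> w.
          move=> [Uw big] e /=; rewrite inE => /predU1P[->|el].
            by rewrite B'p /= last_rcons.
          by rewrite B'l//; exact: Uw.
        move=> H; split.
          move=> e el; rewrite -[X in (_ @^-1` X) _]B'l//.
          by apply: H; rewrite /= inE [_ \in _]el orbT.
        have := H (last_edge p); rewrite B'p /= last_rcons; apply.
        exact: mem_head.
      move=> A mA; rewrite DB.
      apply: (@indep_rvs_cons _ _ _ _ _ _ _ (fun e => xi e.1 e.2) F B' s f A).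
      + exact: ind.
      + by move=> e; exact: law.
      + by move=> e; rewrite /B'; case: ifP => _; exact: measurable_itv.
      + by rewrite /s /= pl.
      + apply/negP => /mapP[p' + [_ fp']].
        rewrite inE => /predU1P[p'E|p'l].
          have := ltn_ord k; rewrite -ltnS fp' p'E size_rcons ltnn.
          by [].
        have := allP lep _ p'l; rewrite /= -fp' size_rcons ltnS.
        by rewrite leqNgt ltn_ord.
      + exact: mA.
    - by apply/measurable_EFinP; apply: measurable_maxr => //;
        apply: measurable_funN.
    - by move=> t; rewrite lee_fin le_max lexx orbT.
    - by rewrite mE.
  have /fineK <- : P D \is a fin_num by rewrite fin_num_measure.
  have pd0 : 0 <= fine (P D) by rewrite fine_ge0.
  set pd := fine (P D) in pd0 *; rewrite -EFinM.
  rewrite sumEFin sumr_const card_ord -!EFinM lee_fin.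
  rewrite mulrC ler_pdivrMr// -[_ *+ size q]mulr_natr.
  have -> : 2 * m / K * pd * (K / 2 * N) = pd * m * N.
    by field; rewrite gt_eqF.
  by rewrite ler_wpM2l ?mulr_ge0// /N ler_nat size_rcons.
apply: (@le_trans _ _ ((2 * m / K)%:E * (1 - P (U l)) +
    (2 * m / K)%:E * (P (U l) - P (U (p :: l))))%E).
  have mG : measurable (D `&` [set w | K / 2 * N <= g w]).
    apply: measurableI => //; rewrite -[X in measurable X]setTI.
    rewrite (_ : [set w | _] = g @^-1` `[K / 2 * N, +oo[).
      by apply: mg => //; exact: measurable_itv.
    by apply/seteqP; split=> w /=; rewrite in_itv /= andbT.
  apply: (@le_trans _ _ (P (V l `\` U l) +
      P (D `&` [set w | (K / 2 * N <= g w)%R]))%E).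
    have mVU q' : measurable (V q' `\` U q') by exact: measurableD.
    apply: (@le_trans _ _ (P ((V l `\` U l) `|`
        (D `&` [set w | (K / 2 * N <= g w)%R])))); last exact: measureU2.
    by apply: le_measure; rewrite ?inE//; exact: measurableU.
  by apply: leeD; [exact: IH|rewrite -PD].
have /fineK <- : P (U l) \is a fin_num by rewrite fin_num_measure.
have /fineK <- : P (U (p :: l)) \is a fin_num by rewrite fin_num_measure.
rewrite -!EFinB -!EFinM -EFinD lee_fin -mulrDr.
by apply: ler_wpM2l => //; lra.
Qed.

(** * Trees with many paths *)

Lemma size_root_paths (z : nat -> nat -> nat) (n : nat) (p : seq nat) :
  p \in root_paths z n -> size p = n.
Proof.
elim: n p => [|n IH] p; first by rewrite inE => /eqP ->.
by move=> /allpairsPdep[q [v [/IH <- _ ->]]]; rewrite size_rcons.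
Qed.

(** The paths from the root whose lengths belong to [s]. *)
Definition paths_in (z : nat -> nat -> nat) (s : seq nat) : seq (seq nat) :=
  flatten [seq root_paths z n | n <- s].

Lemma size_paths_in (z : nat -> nat -> nat) (s : seq nat) (p : seq nat) :
  p \in paths_in z s -> size p \in s.
Proof. by move=> /flatten_mapP[n ns /size_root_paths ->]. Qed.

Lemma paths_in_le (z : nat -> nat -> nat) (s : seq nat) (M : nat) :
  {in s, forall n, n <= M}%N -> {subset paths_in z s <= root_paths_le z M}.
Proof.
move=> sM p /flatten_mapP[n ns pn]; apply/flatten_mapP; exists n => //.
by rewrite mem_iota /= ltnS sM.
Qed.

Lemma uniq_last_edge (z : nat -> nat -> nat) (s : seq nat) :
  uniq s -> uniq [seq last_edge p | p <- paths_in z s].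
Proof.
elim: s => [//|n s IH] /= /andP[ns us].
rewrite /paths_in /= map_cat cat_uniq IH// andbT; apply/andP; split.
  apply: (@map_uniq _ _ fst).
  by rewrite -map_comp (last_root_paths z n : map _ _ = _) iota_uniq.
apply/hasPn => e /mapP[p /size_paths_in ps ->]; apply/negP.
by move=> /mapP[q /size_root_paths qn [_ pq]]; rewrite pq qn (negbTE ns) in ps.
Qed.

Lemma pairwise_paths_in (z : nat -> nat -> nat) (s : seq nat) :
  pairwise leq s -> pairwise (fun p q => size p <= size q)%N (paths_in z s).
Proof.
elim: s => [//|n s IH] /= /andP[ns ps]; rewrite /paths_in /= pairwise_cat.
rewrite IH// andbT; apply/andP; split.
  apply/allrelP => p q /size_root_paths -> /size_paths_in qs.
  exact: (allP ns).
have : all (fun p => size p == n) (root_paths z n).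
  by apply/allP => p /size_root_paths ->.
elim: (root_paths z n) => [//|p l IHl] /= /andP[/eqP -> al].
by rewrite IHl// andbT; apply/allP => q /(allP al)/eqP ->.
Qed.

Lemma sum_paths_in (z : nat -> nat -> nat) (s : seq nat) (R : realType)
  (f : nat -> R) :
  \sum_(p <- paths_in z s) f (size p) = \sum_(n <- s) (gen_size z n)%:R * f n.
Proof.
rewrite big_flatten big_map; apply: eq_bigr => n _.
rewrite big_seq (eq_bigr (fun=> f n)); last first.
  by move=> p /size_root_paths ->.
rewrite -big_seq big_const_seq count_predT iter_addr_0 mulr_natl.
by rewrite -(size_map (last 1%N)) last_root_paths size_iota.
Qed.

(** A bound on the probability of having no big step, by independence of the increments
    on distinct edges and [1 - t <= exp (- t)]. *)
Lemma no_big_step_le (d : measure_display) (T : measurableType d)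
  (R : realType) (P : probability T R)
  (xi : nat -> nat -> {RV P >-> measurableTypeR R})
  (F : probability (measurableTypeR R) R) (K : R) (l : seq (seq nat)) :
  independent_rvs P [set: nat * nat]
     (fun ik => xi ik.1 ik.2 : T -> measurableTypeR R) ->
  (forall i k : nat, has_law (xi i k) F) ->
  uniq [seq last_edge p | p <- l] ->
  (P (no_big_step (fun i k w => xi i k w) K l) <=
   (expR (- \sum_(p <- l) fine (F `]K * (size p)%:R, +oo[%classic)))%:E)%E.
Proof.
move=> ind law ul.
pose B (e : nat * nat) := `]-oo, (K * e.2%:R)]%classic : set R.
have mB e : measurable (B e) by exact: measurable_itv.
apply: (@le_trans _ _ (\prod_(e <- [seq last_edge p | p <- l]) F (B e))%E).
  rewrite le_eqVlt; apply/orP; left; apply/eqP.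
  exact: (indep_rvs_seq (X := fun e => xi e.1 e.2) ind
    (fun e => law e.1 e.2) mB ul).
rewrite big_map -sumrN expR_sum.
elim: l {ul} => [|p l IH]; first by rewrite !big_nil.
rewrite !big_cons EFinM; apply: lee_pmul => //.
  by rewrite big_seq; apply: prode_ge0.
pose C := `]K * (size p)%:R, +oo[%classic : set R.
have -> : B (last_edge p) = ~` C by rewrite setCitvr.
rewrite probability_setC//; last exact: measurable_itv.
have /fineK <- : F C \is a fin_num.
  by rewrite fin_num_measure//; exact: measurable_itv.
by rewrite -EFinB lee_fin; apply: (le_trans _ (expR_ge1Dx _)).
Qed.

(** * Heavy right tails *)

(** With [lambda = ln b / K], the function [exp (lambda * t)] is at most [b ^ 2]
    times [1 + sum_n b ^ n 1_(t > K n)], so the heavy tail makes the integral of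
    this sum infinite. *)
Lemma heavy_right_tail_series (R : realType)
  (F : probability (measurableTypeR R) R) (b K : R) :
  heavy_right_tail F -> 1 < b -> 0 < K ->
  (\sum_(0 <= n <oo) (b ^+ n)%:E * F `](K * n%:R)%R, +oo[%classic = +oo)%E.
Proof.
move=> heavy b1 K0; have b0 : 0 < b by lra.
pose lambda := ln b / K.
have lambda0 : 0 < lambda by rewrite divr_gt0// ln_gt0.
pose A (n : nat) := `]K * n%:R, +oo[%classic : set (measurableTypeR R).
have mA n : measurable (A n) by exact: measurable_itv.
pose f n (t : R) : \bar R := ((b ^+ n)%:E * (\1_(A n) t)%:E)%E.
have f0 n t : (0 <= f n t)%E by rewrite mule_ge0// lee_fin exprn_ge0// ltW.
have mind n : measurable_fun [set: measurableTypeR R]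
    (fun t => (\1_(A n) t)%:E : \bar R).
  by apply/measurable_EFinP; exact: measurable_indic.
have mf n : measurable_fun [set: measurableTypeR R] (f n).
  by apply: measurable_funeM.
have S0 t : (0 <= \sum_(0 <= n <oo) f n t)%E by exact: nneseries_ge0.
have bound t : ((expR (lambda * t))%:E <=
    (b ^+ 2)%:E * (1 + \sum_(0 <= n <oo) f n t))%E.
  have [t0|t0] := ltP t K.
    apply: (@le_trans _ _ ((b ^+ 2)%:E * 1)%E); last first.
      by apply: lee_wpmul2l; rewrite ?lee_fin ?exprn_ge0 ?(ltW b0)// leeDl.
    rewrite mule1 lee_fin; apply: (@le_trans _ _ b); last first.
      by rewrite expr2 ler_pMl// ltW.
    rewrite -[leRHS]lnK ?posrE// ler_expR.
    rewrite /lambda -mulrA ler_piMr ?ln_ge0 ?(ltW b1)//.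
    by rewrite mulrC ler_pdivrMr ?mul1r// ltW.
  (* with m = floor (t / K), the term of index m - 1 is present even when
     t = K * m, which costs the second factor b *)
  pose m := Num.truncn (t / K).
  have tK0 : 0 <= t / K.
    by apply: divr_ge0; [exact: (le_trans (ltW K0) t0)|exact: ltW].
  have /andP[m1 m2] : m%:R <= t / K < m.+1%:R by exact: truncn_itv.
  have m0 : (0 < m)%N by rewrite truncn_gt0 ler_pdivlMr ?mul1r.
  have fm : f m.-1 t = (b ^+ m.-1)%:E.
    suff Am : A m.-1 t by rewrite /f indicE mem_set// mule1.
    rewrite /A /= in_itv /= andbT mulrC -ltr_pdivlMr//; apply: lt_le_trans m1.
    by rewrite ltr_nat prednK.
  apply: (@le_trans _ _ ((b ^+ 2)%:E * f m.-1 t)%E); last first.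
    apply: lee_wpmul2l; first by rewrite lee_fin exprn_ge0// ltW.
    apply: (@le_trans _ _ (\sum_(0 <= n <oo) f n t)%E); last by rewrite leeDr.
    apply: (@le_trans _ _ (\sum_(0 <= n < m) f n t)%E); last first.
      by apply: nneseries_lim_ge => n _ _.
    rewrite -[in leRHS](prednK m0) big_nat_recr//= leeDr//.
    by apply: sume_ge0 => n _.
  rewrite fm -EFinM lee_fin -exprD addnC addn2 prednK//.
  rewrite -[leRHS]lnK ?posrE ?exprn_gt0// ler_expR lnXn//.
  rewrite /lambda mulrAC -mulrA -mulr_natl mulrC.
  by apply: ler_wpM2r; [exact: ln_ge0 (ltW b1)|exact: ltW].
have mexp : measurable_fun [set: measurableTypeR R]
    (fun t => (expR (lambda * t))%:E : \bar R).
  apply/measurable_EFinP; apply: (measurableT_comp (@measurable_expR R)).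
  exact: measurable_funM.
have := heavy _ lambda0.
have mS : measurable_fun [set: measurableTypeR R]
    (fun t => \sum_(0 <= n <oo) f n t)%E.
  by apply: ge0_emeasurable_sum.
have le1 : (\int[F]_t (expR (lambda * t))%:E <=
    (b ^+ 2)%:E * (1 + \sum_(0 <= n <oo) (b ^+ n)%:E * F (A n)))%E.
  apply: (@le_trans _ _ (\int[F]_t
      ((b ^+ 2)%:E * (1 + \sum_(0 <= n <oo) f n t)))%E).
    apply: ge0_le_integral => //.
    by apply: measurable_funeM; exact: emeasurable_funD.
  rewrite ge0_integralZl//; last 3 first.
  - exact: emeasurable_funD.
  - by move=> t _; rewrite adde_ge0.
  - by rewrite lee_fin exprn_ge0// ltW.
  apply: lee_wpmul2l; first by rewrite lee_fin exprn_ge0// ltW.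
  rewrite ge0_integralD// integral_cst// mul1e; apply: leeD.
    exact: probability_le1.
  rewrite integral_nneseries//; apply: lee_nneseries => n _.
    by move=> _; exact: integral_ge0.
  rewrite ge0_integralZl//; last by rewrite lee_fin exprn_ge0// ltW.
  by rewrite integral_indic// setIT.
move=> E; move: le1; rewrite E leye_eq => /eqP.
have : (0 <= \sum_(0 <= n <oo) (b ^+ n)%:E * F (A n))%E.
  by apply: nneseries_ge0 => n _ _; rewrite mule_ge0// lee_fin exprn_ge0// ltW.
case: (\sum_(0 <= n <oo) _)%E => [s| |]//.
Qed.

Lemma heavy_right_tail_sum (R : realType)
  (F : probability (measurableTypeR R) R) (b K A : R) (N : nat) :
  heavy_right_tail F -> 1 < b -> 0 < K ->
  exists M, A <= \sum_(N <= n < M.+1)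
    b ^+ n * fine (F `](K * n%:R)%R, +oo[%classic).
Proof.
move=> heavy b1 K0; have b0 : 0 < b by lra.
pose u n := b ^+ n * fine (F `](K * n%:R)%R, +oo[%classic).
have u0 n : 0 <= u n by rewrite mulr_ge0 ?exprn_ge0 ?fine_ge0// ltW.
have uE n : ((u n)%:E = (b ^+ n)%:E * F `](K * n%:R)%R, +oo[%classic)%E.
  by rewrite EFinM fineK// fin_num_measure//; exact: measurable_itv.
apply: contrapT => /forallNP H.
have := heavy_right_tail_series heavy b1 K0.
suff : (\sum_(0 <= n <oo) (u n)%:E <= (\sum_(0 <= n < N) u n + A)%:E)%E.
  by under eq_eseriesr do rewrite uE; move=> + E; rewrite E.
apply: lime_le.
  by apply: is_cvg_nneseries => n _ _; rewrite lee_fin.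
near=> M; rewrite sumEFin lee_fin.
have NM : (N < M)%N by near: M; exact: nbhs_infty_gt.
rewrite (big_cat_nat (n := N)) ?(ltnW NM)//= lerD2l.
have := H M.-1; rewrite prednK ?(leq_ltn_trans _ NM)//.
by move/negP; rewrite -ltNge => /ltW.
Unshelve. all: by end_near.
Qed.

(** * Conclusion *)

Lemma mean_negative_part (R : realType)
  (F : probability (measurableTypeR R) R) :
  F.-integrable [set: R] (fun t : R => t%:E) ->
  exists2 m : R, 0 <= m & (\int[F]_t (Num.max (- t) 0)%:E = m%:E)%E.
Proof.
move=> Fint; pose h (t : measurableTypeR R) : \bar R := (Num.max (- t) 0)%:E.
have h0 t : (0 <= h t)%E by rewrite lee_fin le_max lexx orbT.
have mh : measurable_fun [set: measurableTypeR R] h.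
  by apply/measurable_EFinP; apply: measurable_maxr => //;
    apply: measurable_funN.
have hint : F.-integrable [set: measurableTypeR R] h.
  apply: (le_integrable _ mh _ Fint) => // t _.
  rewrite gee0_abs//= lee_fin ge_max normr_ge0 andbT.
  by rewrite -normrN ler_norm.
have : (0 <= \int[F]_t h t)%E by apply: integral_ge0 => t _; exact: h0.
have : (\int[F]_t h t)%E \is a fin_num by exact: integrable_fin_num.
case: (\int[F]_t h t)%E => // m _; rewrite lee_fin => m0.
by exists m.
Qed.

(** On a deterministic tree growing at least as [delta * b ^ n], a bound on the
    probability that no path of length at most [M] reaches [B]. Only the paths
    of length at least [N] are used. *)
Lemma low_paths_tree (d : measure_display) (T : measurableType d)
  (R : realType) (P : probability T R)
  (xi : nat -> nat -> {RV P >-> measurableTypeR R})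
  (F : probability (measurableTypeR R) R) (c B K m b delta : R)
  (z : nat -> nat -> nat) (N M : nat) :
  independent_rvs P [set: nat * nat]
     (fun ik => xi ik.1 ik.2 : T -> measurableTypeR R) ->
  (forall i k : nat, has_law (xi i k) F) ->
  (\int[F]_t (Num.max (- t) 0)%:E = m%:E)%E -> 0 <= m ->
  0 < K -> 1 + c <= K / 2 -> (0 < N)%N -> B <= N%:R ->
  (forall n, (n <= M)%N -> delta * b ^+ n <= (gen_size z n)%:R) ->
  (P (low_paths (fun i k w => xi i k w) c B (root_paths_le z M)) <=
   (2 * m / K + expR (- (delta * \sum_(N <= n < M.+1)
      b ^+ n * fine (F `](K * n%:R)%R, +oo[%classic))))%:E)%E.
Proof.
move=> ind law mE m0 K0 Kc N0 BN growth.
pose x i k w := xi i k w : R.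
have mx i k : measurable_fun [set: T] (x i k).
  exact: (measurable_funPT (xi i k)).
pose s := index_iota N M.+1; pose l := paths_in z s.
have sE n : (n \in s) = (N <= n <= M)%N by rewrite mem_index_iota ltnS.
have ul : uniq [seq last_edge p | p <- l] by rewrite uniq_last_edge// iota_uniq.
pose V := low_paths x c B l; pose U := no_big_step x K l.
have mV : measurable V by exact: measurable_low_paths.
have mU : measurable U by exact: measurable_no_big_step.
apply: (@le_trans _ _ (P ((V `\` U) `|` U))).
  apply: le_measure; rewrite ?inE.
  - exact: measurable_low_paths.
  - by apply: measurableU => //; exact: measurableD.
  move=> w Vw; have [|nU] := pselect (U w); [by right|left; split=> // p pl].
  by apply: Vw; apply: (paths_in_le (s := s)) => // n; rewrite sE => /andP[].
apply: (le_trans (measureU2 _ _ _)) => //; first exact: measurableD.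
rewrite EFinD; apply: leeD.
  apply: (@le_trans _ _ ((2 * m / K)%:E * (1 - P U))%E).
    apply: (low_paths_big_step ind law mE K0 Kc ul).
      apply: pairwise_paths_in; rewrite -sorted_pairwise; last exact: leq_trans.
      exact: iota_sorted.
    move=> p /size_paths_in; rewrite sE => /andP[Np _].
    by rewrite (leq_trans N0 Np) (le_trans BN)// ler_nat.
  rewrite -[leRHS]mule1; apply: lee_wpmul2l.
    by rewrite lee_fin divr_ge0 ?mulr_ge0// ltW.
  by rewrite leeBlDr ?fin_num_measure// leeDl.
apply: (le_trans (no_big_step_le K ind law ul)).
rewrite lee_fin ler_expR lerN2.
rewrite (sum_paths_in z s (fun n => fine (F `](K * n%:R)%R, +oo[%classic))).
rewrite mulr_sumr; apply: ler_sum_nat => n /andP[_ nM].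
by rewrite mulrA ler_wpM2r ?fine_ge0//; exact: growth.
Qed.

(** For every [B], the event that all paths have values below [B] has
    probability 0: its probability is at most [eta] for all [eta > 0], by the
    choice of a large [K], a small [delta] and then a large [M], so that each of
    the three error terms (cancelled big step, slow growth, no big step) is at
    most [eta / 3]. *)
Lemma low_paths_negligible (d : measure_display) (T : measurableType d)
  (R : realType) (P : probability T R)
  (zeta : nat -> nat -> {RV P >-> nat})
  (xi : nat -> nat -> {RV P >-> measurableTypeR R})
  (G : probability nat R) (F : probability (measurableTypeR R) R) (c B : R) :
  independent_systems P [set: nat]
    (fun n => sigma_generated [set j | (1 <= j)%N]
                (fun j => zeta n j : T -> nat)) ->
  (forall n j : nat, (1 <= j)%N -> has_law (zeta n j) G) ->
  independent_rvs P [set: nat * nat]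
    (fun ik => xi ik.1 ik.2 : T -> measurableTypeR R) ->
  (forall i k : nat, has_law (xi i k) F) ->
  independent2 P
    (sigma_generated [set: nat * nat]
       (fun ik => xi ik.1 ik.2 : T -> measurableTypeR R))
    (sigma_generated [set nj : nat * nat | (1 <= nj.2)%N]
       (fun nj => zeta nj.1 nj.2 : T -> nat)) ->
  F.-integrable [set: R] (fun t : R => t%:E) ->
  G [set 0%N] = 0%E -> (0 < G [set k | (1 < k)%N])%E ->
  heavy_right_tail F ->
  P.-negligible [set w | forall M, low_paths (fun i k w => xi i k w) c B
    (root_paths_le (fun m j => zeta m j w) M) w].
Proof.
move=> zeta_ind zeta_law xi_ind xi_law xi_zeta_ind Fint G0 q0 heavy.
have [b [C [b1 C0 slow]]] := slow_growth_prob zeta_ind zeta_law G0 q0.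
have [m m0 mE] := mean_negative_part Fint.
pose X M w := root_paths_le (fun m j => zeta m j w) M.
pose E := low_paths (fun i k w => xi i k w) c B.
pose Gxi := sigma_generated [set: nat * nat]
  (fun ik => xi ik.1 ik.2 : T -> measurableTypeR R).
pose Gzeta := sigma_generated [set nj : nat * nat | (1 <= nj.2)%N]
  (fun nj => zeta nj.1 nj.2 : T -> nat).
have GE l : Gxi (E l).
  apply: (@measurable_low_paths _ (generated_space [set: nat * nat]
    (fun ik => xi ik.1 ik.2 : T -> measurableTypeR R)) R) => i k _ A mA.
  rewrite setTI; exact: (@sigma_generated_preimage _ _ _ _ _ [set: nat * nat]
    (fun ik => xi ik.1 ik.2 : T -> measurableTypeR R) (i, k)).
have GX M l : Gzeta (X M @^-1` [set l]).
  apply: (@discrete_root_paths_le _ (generated_space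
    [set nj : nat * nat | (1 <= nj.2)%N]
    (fun nj => zeta nj.1 nj.2 : T -> nat)) zeta M _ l) => n j j1.
  exact: (@discrete_generated _ _ _ [set nj : nat * nat | (1 <= nj.2)%N]
    (fun nj => zeta nj.1 nj.2 : T -> nat) (n, j)).
have Gxim : Gxi `<=` measurable.
  by apply: sigma_generated_measurable => i; exact: measurable_funPT.
have Gzetam : Gzeta `<=` measurable.
  by apply: sigma_generated_measurable => i; exact: measurable_funPT.
have cond M A eta := measure_discrete_conditioning (A := A) (eta := eta)
  xi_zeta_ind Gxim Gzetam (GX M) GE.
pose Q := [set w | forall M, E (X M w) w].
have mQ : measurable Q.
  rewrite (_ : Q = \bigcap_M [set w | setT (X M w) /\ E (X M w) w]).
    apply: bigcapT_measurable => M.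
    have [] := cond M setT 1 => // l _.
    by apply: probability_le1; apply: Gxim.
  apply/seteqP; split=> w H M; first by split.
  by have [] := H M I.
apply/negligibleP => //; apply/eqP; rewrite eq_le measure_ge0 andbT.
apply/lee_addgt0Pr => eta eta0; rewrite add0e.
pose K := 2 * (1 + `|c|) + 6 * m / eta.
have K0 : 0 < K.
  have : 0 <= 6 * m / eta by rewrite divr_ge0 ?mulr_ge0 ?(ltW eta0).
  have := normr_ge0 c; rewrite /K; lra.
have Kc : 1 + c <= K / 2.
  have : 0 <= 6 * m / eta by rewrite divr_ge0 ?mulr_ge0 ?(ltW eta0).
  have := ler_norm c; rewrite /K; lra.
have Km : 2 * m / K <= eta / 3.
  rewrite ler_pdivrMr// /K mulrDr (_ : eta / 3 * (6 * m / eta) = 2 * m).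
    by rewrite lerDr !mulr_ge0 ?addr_ge0 ?(ltW eta0).
  by field; rewrite gt_eqF.
pose delta := eta / (3 * C).
have delta0 : 0 < delta by rewrite divr_gt0// mulr_gt0.
pose N := (Num.truncn `|B|).+1.
have BN : B <= N%:R.
  by apply: (le_trans (ler_norm B)); apply: ltW; exact: truncnS_gt.
have [M HM] := heavy_right_tail_sum (- ln (eta / 3) / delta) N heavy b1 K0.
have [mS PS] := slow delta M delta0.
pose S := slow_growth (fun m j w => zeta m j w) b delta M.
rewrite -/S in mS PS.
(* trees that coincide up to generation M with one that grows fast enough *)
pose A l := exists2 w, X M w = l & ~ S w.
have eta23 : 0 <= 2 * eta / 3 by rewrite divr_ge0 ?mulr_ge0 ?(ltW eta0).
have [|mW PW] := cond M A (2 * eta / 3) _ eta23.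
  move=> l [w0 <- nS].
  apply: le_trans (low_paths_tree (b := b) (delta := delta) (N := N)
    xi_ind xi_law mE m0 K0 Kc _ BN _) _ => //.
    move=> n nM; rewrite leNgt; apply/negP => H; apply: nS.
    by exists n.
  rewrite lee_fin.
  suff H : expR (- (delta * \sum_(N <= n < M.+1) b ^+ n *
      fine (F `](K * n%:R)%R, +oo[%classic))) <= eta / 3 by lra.
  rewrite -[leRHS]lnK ?posrE ?divr_gt0// ler_expR lerNl.
  by rewrite [leRHS]mulrC -ler_pdivrMr.
apply: (@le_trans _ _ (P (S `|` [set w | A (X M w) /\ E (X M w) w]))).
  apply: le_measure; rewrite ?inE//; first exact: measurableU.
  move=> w Qw; have [Sw|nS] := pselect (S w); [by left|right].
  by split; [exists w|exact: Qw].
apply: (le_trans (measureU2 _ _ _)) => //.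
apply: (@le_trans _ _ ((C * delta)%:E + (2 * eta / 3)%:E)%E).
  exact: leeD.
rewrite -EFinD lee_fin /delta.
have -> : C * (eta / (3 * C)) = eta / 3 by field; rewrite gt_eqF.
lra.
Qed.

Unset Implicit Arguments.

Theorem proposition5 (d : measure_display) (T : measurableType d)
  (R : realType) (P : probability T R)
  (* offspring numbers zeta n j, n >= 0, j >= 1 *)
  (zeta : nat -> nat -> {RV P >-> nat})
  (* increments xi i k, i, k >= 0 *)
  (xi : nat -> nat -> {RV P >-> measurableTypeR R})
  (G : probability nat R) (F : probability (measurableTypeR R) R)
  (zeta_indep_row : forall n : nat,
     independent_rvs P [set j | (1 <= j)%N] (fun j => zeta n j : T -> nat))
  (zeta_indep_gen : independent_systems P [set: nat]
     (fun n => sigma_generated [set j | (1 <= j)%N]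
                 (fun j => zeta n j : T -> nat)))
  (zeta_law : forall n j : nat, (1 <= j)%N -> has_law (zeta n j) G)
  (xi_indep : independent_rvs P [set: nat * nat]
     (fun ik => xi ik.1 ik.2 : T -> measurableTypeR R))
  (xi_law : forall i k : nat, has_law (xi i k) F)
  (xi_zeta_indep : independent2 P
     (sigma_generated [set: nat * nat]
        (fun ik => xi ik.1 ik.2 : T -> measurableTypeR R))
     (sigma_generated [set nj : nat * nat | (1 <= nj.2)%N]
        (fun nj => zeta nj.1 nj.2 : T -> nat)))
  (F_integrable : F.-integrable [set: R] (fun t : R => t%:E))
  (F_mean0 : (\int[F]_t t%:E = 0)%E)
  (zeta_ge1 : forall n : nat, {ae P, forall w, (1 <= zeta n 1 w)%N})
  (q_gt0 : (0 < P [set w | (1 < zeta 1 1 w)%N])%E)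
  (F_heavy : heavy_right_tail F)
  (c : R) :
  {ae P, forall w,
     ereal_sup (range (fun n : nat =>
       (path_max (fun m j => zeta m j w) (fun i k => xi i k w) c n)%:E))
     = +oo%E}.
Proof.
have G0 : G [set 0%N] = 0%E.
  rewrite -(zeta_law 1%N 1%N)//.
  rewrite (_ : distribution P (zeta 1%N 1%N) [set 0%N] =
    P (~` [set w | (1 <= zeta 1%N 1%N w)%N])).
    apply/negligibleP; last exact: zeta_ge1.
    apply: measurableC; rewrite -[X in measurable X]setTI.
    by apply: (measurable_funPT (zeta 1%N 1%N) measurableT [set k | (1 <= k)%N]).
  congr (P _); apply/seteqP; split=> w /=; first by move=> ->.
  by move/negP; rewrite -leqNgt leqn0 => /eqP.
have Gq : (0 < G [set k | (1 < k)%N])%E by rewrite -(zeta_law 1%N 1%N).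
have null (B : nat) := low_paths_negligible c B%:R zeta_indep_gen zeta_law
  xi_indep xi_law xi_zeta_indep F_integrable G0 Gq F_heavy.
apply: negligibleS (negligible_bigcup null) => w /= sup_neq.
set s := ereal_sup _ in sup_neq.
have [B sB] : exists B : nat, (s < B%:R%:E)%E.
  case: s sup_neq => [r| |] // _; last by exists 0%N; rewrite ltNyr.
  exists (Num.truncn `|r|).+1; rewrite lte_fin.
  by apply: (le_lt_trans (ler_norm r)); exact: truncnS_gt.
exists B => // M p pM.
have : ((path_max (fun m j => zeta m j w) (fun i k => xi i k w) c M)%:E <= s)%E.
  by apply: ereal_sup_ubound; exists M.
move=> /le_lt_trans /(_ sB); rewrite lte_fin; apply: le_lt_trans.
exact: (@le_bigmax_seq _ _ _ _ 0 p predT (fun q =>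
  path_sum (fun i k => xi i k w) q - c * (size q)%:R) pM isT).
Qed.
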